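(* Let $G=(V,E)$ be a finite simple graph with nonempty vertex set, let $c$ be a proper coloring of $G$, and let $t=\operatorname{coind}(B_0(G))+1$. Then there is a sequence $(A_1,B_1),\ldots,(A_s,B_s)$ of pairs of disjoint subsets of $V$ such that $A_1=B_s$, $A_s=B_1$, $\big||A_1|-|B_1|\big|\le 1$, $|c(A_1\cup B_1)|=t$ (the first subgraph is heterochromatic), and such that: \begin{itemize} \item for every $i\in\{1,\ldots,s\}$, $G[A_i,B_i]$ is a complete bipartite graph; \item for every $i\in\{1,\ldots,s\}$, $|A_i\cup B_i|=t$; \item for every $i\in\{1,\ldots,s-1\}$, $|A_i\setminus A_{i+1}|+|B_i\setminus B_{i+1}|=|A_{i+1}\setminus A_i|+|B_{i+1}\setminus B_i|=1$ (adjacency); \item for every $i\in\{1,\ldots,s\}$, $\big||A_i|-|B_i|\big|\le 2$ (balancedness); \item for every $i\in\{1,\ldots,s\}$, $|c(A_i\cup B_i)|\ge t-1$ (almost heterochromaticity). \end{itemize}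
   Context: For disjoint $A,B\subseteq V$, $G[A,B]$ is the bipartite graph with sides $A$ and $B$ whose edges are the edges of $G$ with one endpoint in $A$ and the other in $B$; it is complete if every vertex of $A$ is adjacent to every vertex of $B$ (automatically true if $A$ or $B$ is empty). The box complex $B_0(G)$ is the simplicial complex with vertex set $V\uplus V=V\times\{1,2\}$ and simplices all sets $A\uplus B=(A\times\{1\})\cup(B\times\{2\})$ with $A,B\subseteq V$, $A\cap B=\varnothing$ and $G[A,B]$ complete bipartite. It carries the free $\mathbb{Z}_2$-action interchanging $(v,1)$ and $(v,2)$ for each $v\in V$, extended affinely to the underlying space $\|B_0(G)\|$. A $\mathbb{Z}_2$-space is a topological space with a homeomorphism $\nu$ satisfying $\nu\circ\nu=\mathrm{id}$; a $\mathbb{Z}_2$-map between $\mathbb{Z}_2$-spaces is a continuous map commuting with the actions. The sphere $\mathcal{S}^d$ carries the antipodal action $x\mapsto -x$. The $\mathbb{Z}_2$-coindex of a $\mathbb{Z}_2$-space $X$ is $\operatorname{coind}(X)=\max\{d\ge 0: \text{there is a } \mathbb{Z}_2\text{-map } \mathcal{S}^d\to X\}$, and $\operatorname{coind}(B_0(G))=\operatorname{coind}(\|B_0(G)\|)$. *)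

(* Defs.v *)
From HB Require Import structures.
From mathcomp Require Import all_boot all_order all_algebra.
From mathcomp Require Import all_classical all_reals all_analysis.

Set Implicit Arguments.
Unset Strict Implicit.
Unset Printing Implicit Defensive.

Import Order.TTheory GRing.Theory Num.Theory.
Import numFieldNormedType.Exports.

Local Open Scope ring_scope.

(** * Z2-spaces and the Z2-coindex *)

Record z2space := Z2Space {
  z2_sort :> topologicalType;
  z2_act : z2_sort -> z2_sort;
  z2_act_continuous : continuous z2_act;
  z2_actK : involutive z2_act }.

Definition z2map (X Y : z2space) (f : X -> Y) : Prop :=
  continuous f /\ forall x, f (z2_act x) = z2_act (f x).

(* An involution of an ambient space preserving a subset [A] makes [A], with
   the subspace topology (that of [set_type]), a Z2-space. *)
Section Z2Subspace.
Variables (X : topologicalType) (A : set X) (nu : X -> X).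
Hypotheses (nu_cont : continuous nu) (nuK : involutive nu).
Hypothesis nuA : forall x, A x -> A (nu x).

Definition sub_act (x : set_type A) : set_type A :=
  exist _ (nu (set_val x)) (mem_set (nuA (set_valP x))).

Lemma sub_act_continuous : continuous sub_act.
Proof.
apply: continuous_comp_initial => x.
apply: (@continuous_comp (set_type A) X X set_val nu); last exact: nu_cont.
exact: initial_continuous.
Qed.

Lemma sub_actK : involutive sub_act.
Proof. by move=> x; apply: val_inj; exact: nuK. Qed.

Definition z2subspace : z2space := Z2Space sub_act_continuous sub_actK.
End Z2Subspace.

Section Sphere.
Variables (R : realType) (d : nat).

(* The norm of the library on ['rV_n] is the sup norm, hence the explicit
   sum of squares. *)
Definition sphere_set : set 'rV[R]_d.+1 :=
  [set x | \sum_(i < d.+1) x ord0 i ^+ 2 = 1]%classic.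

Lemma antipode_continuous : continuous (fun x : 'rV[R]_d.+1 => - x).
Proof. by move=> x; exact: opp_continuous. Qed.

Lemma antipodeK : involutive (fun x : 'rV[R]_d.+1 => - x).
Proof. exact: opprK. Qed.

Lemma antipode_sphere x : sphere_set x -> sphere_set (- x).
Proof.
rewrite /sphere_set /= => <-.
by apply: eq_bigr => i _; rewrite mxE sqrrN.
Qed.

Definition sphere : z2space :=
  z2subspace antipode_continuous antipodeK antipode_sphere.
End Sphere.

Definition has_sphere_map (R : realType) (X : z2space) (d : nat) : Prop :=
  exists f : sphere R d -> X, z2map f.

Definition is_coind (R : realType) (X : z2space) (d : nat) : Prop :=
  has_sphere_map R X d /\
  forall d', has_sphere_map R X d' -> (d' <= d)%N.

(* The maximum, which is unique when it exists (as it does for the box complex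
   of a finite graph with a vertex); [0] when there is no maximum. *)
Definition coind (R : realType) (X : z2space) : nat :=
  xget 0%N [set d | is_coind R X d]%classic.

(** * Underlying space of a finite simplicial complex *)

Lemma precomp_continuous (T : eqType) (X : topologicalType) (s : T -> T) :
  continuous (fun x : {ptws T -> X} => (fun v => x (s v)) : {ptws T -> X}).
Proof.
move=> x; apply/cvg_sup.
  exact/fmap_filter/(nbhs_filter (x : {ptws T -> X})).
move=> v; move: x.
apply/(@continuousP _ (initial_topology (fun f : T -> X => f v))).
move=> A [B oB <-].
have -> : ((fun (x : T -> X) v => x (s v)) @^-1`
    ((fun f : T -> X => f v) @^-1` B))%classic =
    (proj (s v) @^-1` B)%classic by [].
by apply: open_comp => // + _; exact: (@proj_continuous T (fun=> X)).
Qed.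

Section Realization.
Variables (R : realType) (T : finType) (K : {set {set T}}).

(* Points are given by their barycentric coordinates: convex combinations of
   the vertices, supported on a simplex of [K]. *)
Definition realization_set : set {ptws T -> R} :=
  [set x | [/\ forall v, 0 <= x v,
              \sum_(v : T) x v = 1 &
              [set v | x v != 0]%SET \in K]]%classic.

Variable s : T -> T.
Hypothesis sK : involutive s.
Hypothesis s_simplex : forall S, S \in K -> (s @: S)%SET \in K.

(* The affine extension of [s] sends [\sum_v x v * v] to
   [\sum_v x v * s v = \sum_v x (s v) * v]. *)
Definition affine_act (x : {ptws T -> R}) : {ptws T -> R} := fun v => x (s v).

Lemma affine_act_continuous : continuous affine_act.
Proof. exact: precomp_continuous. Qed.

Lemma affine_actK : involutive affine_act.
Proof. by move=> x; apply/funext => v; rewrite /affine_act sK. Qed.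

Lemma affine_act_realization x :
  realization_set x -> realization_set (affine_act x).
Proof.
move=> [x0 x1 xK]; split=> [v||]; first exact: x0.
  rewrite -x1 [RHS](reindex_inj (inv_inj sK)).
  by [].
move: (s_simplex xK); congr (_ \in K); apply/setP => v.
apply/imsetP/idP; rewrite ?inE.
  by move=> [w]; rewrite !inE => xw ->; rewrite /affine_act sK.
by move=> xv; exists (s v); rewrite ?inE ?sK.
Qed.

Definition realization : z2space :=
  z2subspace affine_act_continuous affine_actK affine_act_realization.
End Realization.

(** * Graphs and their box complexes *)

Section BoxComplex.
Variables (V : finType) (e : rel V).

Definition complete_bip (A B : {set V}) : bool :=
  [forall a in A, forall b in B, e a b].

(* [V * bool] is [V * {1, 2}], with [false] for 1 and [true] for 2. *)
Definition dsum (A B : {set V}) : {set V * bool} :=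
  (finset.setX A [set false] :|: finset.setX B [set true])%SET.

Definition box_complex : {set {set V * bool}} :=
  [set dsum P.1 P.2 | P : {set V} * {set V}
    & [disjoint P.1 & P.2] && complete_bip P.1 P.2]%SET.

Definition swap_copies (p : V * bool) : V * bool := (p.1, ~~ p.2).

Lemma swap_copiesK : involutive swap_copies.
Proof. by move=> [v b]; rewrite /swap_copies /= negbK. Qed.

Lemma swap_copies_dsum (A B : {set V}) :
  (swap_copies @: dsum A B)%SET = dsum B A.
Proof.
apply/setP => -[v b]; apply/imsetP/idP.
  by move=> [[w b'] + [-> ->]]; rewrite !inE /= orbC; case: b'.
move=> h; exists (v, ~~ b); last by rewrite /swap_copies /= negbK.
by move: h; rewrite !inE /= orbC; case: b.
Qed.

Hypothesis e_sym : symmetric e.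

Lemma swap_copies_simplex (S : {set V * bool}) :
  S \in box_complex -> (swap_copies @: S)%SET \in box_complex.
Proof.
move=> /imsetP[[A B]]; rewrite inE /= => /andP[dAB cAB ->].
rewrite swap_copies_dsum; apply/imsetP; exists (B, A) => //.
rewrite inE /= disjoint_sym dAB /=.
apply/forall_inP => b bB; apply/forall_inP => a aA; rewrite e_sym.
by move/forall_inP: cAB => /(_ a aA)/forall_inP; exact.
Qed.

Definition B0 (R : realType) : z2space :=
  realization R swap_copiesK swap_copies_simplex.
End BoxComplex.

Definition proper_coloring (V : finType) (e : rel V) (C : eqType)
  (c : V -> C) : Prop := forall u v, e u v -> c u != c v.

(* [#|c(X)|]; the colors may come from an infinite type. *)
Definition ncolors (V : finType) (C : eqType) (c : V -> C) (X : {set V}) : nat :=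
  size (undup [seq c v | v in X]).

(* Main.v *)
Require Import Defs.
From HB Require Import structures.
From mathcomp Require Import all_boot all_order all_algebra.
From mathcomp Require Import all_classical all_reals all_analysis.
From mathcomp Require Import zify.
Import IntDist.

Set Implicit Arguments.
Unset Strict Implicit.
Unset Printing Implicit Defensive.

Import Order.TTheory GRing.Theory Num.Theory.
Import numFieldNormedType.Exports.

(** Let [d] be the coindex of the box complex. A Z2-map from the [d]-sphere,
    evaluated on a fine subdivision of the cross-polytope, gives mod 2 chains
    [h 0, ..., h d] of simplices of the box complex, where the boundary of
    [h k] is [h (k - 1)] plus its antipode.  Coloring the vertices and ordering
    the signed colors as in Ky Fan's theorem, call a simplex alternating if its
    signs alternate along increasing colors.  A simplex has an odd number of
    positive alternating facets iff it is alternating, so Fan's induction on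
    [k] shows that the top cycle [z = h d + nu (h d)] has an odd number of
    antipodal pairs of alternating simplices.

    Join two [d]-simplices when they share an alternating facet. If no
    alternating simplex were joined by a path to its antipode, one could select
    a union [U] of components containing exactly one simplex of each antipodal
    pair of alternating ones.  Counting the positive alternating facets of the
    simplices of [z] lying in [U] gives an even number because [z] is a cycle,
    and an odd number by Fan's count.  A path between antipodal alternating
    simplices is the required sequence: an alternating facet has [d] colors and
    almost equally many vertices on both sides. *)

(** * Mod 2 chains *)

Section Chains.
Variable P : Type.
Implicit Types (Phi : seq P -> bool) (w : seq P) (s : seq (seq P)).

(** The pairing of the mod 2 chain listed by [s] with the cochain [Phi]. *)
Definition ev Phi s : bool := \big[addb/false]_(w <- s) Phi w.

(** Two lists represent the same chain when no cochain tells them apart; equal words thus cancel in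
    pairs without any normal form for lists. *)
Definition chain_eq s1 s2 := forall Phi, ev Phi s1 = ev Phi s2.

(** The empty word is the simplex of dimension -1: [faces [:: x]] is [[:: [::]]], so [bd] is the
    augmented boundary. *)
Fixpoint faces w : seq (seq P) :=
  if w is x :: w' then w' :: map (cons x) (faces w') else [::].

Definition bd s := flatten (map faces s).

Lemma ev_cat Phi s1 s2 : ev Phi (s1 ++ s2) = ev Phi s1 (+) ev Phi s2.
Proof. exact: big_cat. Qed.

Lemma ev_bind Phi (F : seq P -> seq (seq P)) s :
  ev Phi (flatten (map F s)) = ev (fun w => ev Phi (F w)) s.
Proof. by rewrite /ev big_flatten big_map. Qed.

Lemma ev_split Phi1 Phi2 s :
  ev (fun w => Phi1 w (+) Phi2 w) s = ev Phi1 s (+) ev Phi2 s.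
Proof. exact: big_split. Qed.

Lemma eq_ev Phi1 Phi2 s : Phi1 =1 Phi2 -> ev Phi1 s = ev Phi2 s.
Proof. by move=> E; apply: eq_bigr => w _; exact: E. Qed.

Lemma ev_cons Phi x s :
  ev Phi (map (cons x) s) = ev (fun w => Phi (x :: w)) s.
Proof. exact: big_map. Qed.

Lemma ev_faces_cons Phi x w :
  ev Phi (faces (x :: w)) = Phi w (+) ev (fun u => Phi (x :: u)) (faces w).
Proof. by rewrite /ev /= big_cons big_map. Qed.

(** With [x :: w] seen as a cone, [faces w] arises once from the face [w] and once from the faces
    through [x]; the two copies cancel mod 2. *)
Lemma bd_faces w : chain_eq (bd (faces w)) [::].
Proof.
elim: w => [|x w IH] Phi; first by rewrite /bd.
rewrite ev_bind ev_faces_cons.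
have -> : ev (fun u => ev Phi (faces (x :: u))) (faces w) =
    ev Phi (faces w) (+) ev (fun u => Phi (x :: u)) (bd (faces w)).
  by rewrite ev_bind -ev_split; apply: eq_ev => u; exact: ev_faces_cons.
by rewrite addbA addbb addFb IH /ev !big_nil.
Qed.

Lemma bd_cat s1 s2 : bd (s1 ++ s2) = bd s1 ++ bd s2.
Proof. by rewrite /bd map_cat flatten_cat. Qed.

Lemma bd_cone x s : chain_eq (bd (map (cons x) s)) (s ++ map (cons x) (bd s)).
Proof.
move=> Phi; rewrite ev_cat ev_cons !ev_bind ev_cons -ev_split.
by apply: eq_ev => w; exact: ev_faces_cons.
Qed.

End Chains.

Lemma ev_map (P Q : Type) (f : P -> Q) (Phi : seq Q -> bool) s :
  ev Phi (map (map f) s) = ev (fun w => Phi (map f w)) s.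
Proof. exact: big_map. Qed.

Lemma faces_map (P Q : Type) (f : P -> Q) w :
  faces (map f w) = map (map f) (faces w).
Proof.
elim: w => [//|x w IH] /=; congr (_ :: _).
by rewrite IH -!map_comp; apply: eq_map.
Qed.

Lemma bd_map (P Q : Type) (f : P -> Q) s :
  bd (map (map f) s) = map (map f) (bd s).
Proof.
rewrite /bd map_flatten -!map_comp; congr flatten.
by apply: eq_map => w; exact: faces_map.
Qed.

Lemma chain_eq_map (P Q : Type) (f : P -> Q) s1 s2 :
  chain_eq s1 s2 -> chain_eq (map (map f) s1) (map (map f) s2).
Proof. by move=> E Phi; rewrite !ev_map. Qed.

Lemma eq_ev_in (P : eqType) (Phi1 Phi2 : seq P -> bool) s :
  {in s, Phi1 =1 Phi2} -> ev Phi1 s = ev Phi2 s.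
Proof. by move=> E; apply: eq_big_seq. Qed.

Lemma faces_subseq (P : eqType) (w u : seq P) : u \in faces w -> subseq u w.
Proof.
elim: w u => [//|x w IH] u; rewrite inE => /orP[/eqP ->|].
  exact: subseq_cons.
by move=> /mapP[u' /IH su ->] /=; rewrite eqxx.
Qed.

Lemma size_faces (P : eqType) (w u : seq P) :
  u \in faces w -> size w = (size u).+1.
Proof.
elim: w u => [//|x w IH] u; rewrite inE => /orP[/eqP -> //|].
by move=> /mapP[u' /IH su ->] /=; rewrite su.
Qed.

(** Words are ordered, whereas alternation is read off after sorting; this allows a word to be
    sorted before its facets are taken. *)
Lemma ev_faces_perm (P : eqType) (Phi : seq P -> bool) w1 w2 :
  (forall u1 u2, perm_eq u1 u2 -> Phi u1 = Phi u2) ->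
  perm_eq w1 w2 -> ev Phi (faces w1) = ev Phi (faces w2).
Proof.
(* [rem] deletes the first occurrence of a letter; for a repeated letter, deleting another
   occurrence gives a permutation of the same word. *)
have faces_rem (Psi : seq P -> bool) w :
    (forall u1 u2, perm_eq u1 u2 -> Psi u1 = Psi u2) ->
    ev Psi (faces w) = \big[addb/false]_(x <- w) Psi (rem x w).
  elim: w Psi => [|x w IH] Psi invPsi; first by rewrite /ev !big_nil.
  rewrite ev_faces_cons big_cons /= eqxx IH; last first.
    by move=> u1 u2 u12; apply: invPsi; rewrite perm_cons.
  congr addb; apply: eq_big_seq => y yw /=; case: eqP => // ->.
  by apply: invPsi; rewrite perm_sym; exact: perm_to_rem.
move=> invPhi w12; rewrite !faces_rem // (perm_big _ w12).
apply: eq_big_seq => x xw2; apply: invPhi; rewrite -(perm_cons x).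
rewrite -(permPl (perm_to_rem _)) ?(perm_mem w12) // (perm_trans w12) //.
exact: perm_to_rem.
Qed.

(** * Antipodally symmetric sphere chains *)

Section SphereChain.
Variables (P : Type) (nu : P -> P) (h : nat -> seq (seq P)).
Hypothesis nuK : involutive nu.

(* For [h k] a hemisphere of dimension [k], this is the sphere of dimension
   [k - 1]; the sphere of dimension -1 is the augmentation [:: [:: ]]. *)
Definition sphere_chain (k : nat) : seq (seq P) :=
  if k is k'.+1 then h k' ++ map (map nu) (h k') else [:: [::]].

Lemma sphere_chain_anti k :
  chain_eq (map (map nu) (sphere_chain k)) (sphere_chain k).
Proof.
case: k => [//|k] Phi /=; rewrite map_cat !ev_cat addbC; congr addb.
rewrite -map_comp -[RHS]/(ev Phi (h k)) -[h k in RHS]map_id; congr ev.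
by apply: eq_map => w /=; rewrite (mapK nuK).
Qed.

(** The boundary is a lower sphere plus its antipode, and mod 2 that sphere equals its antipode. *)
Lemma sphere_chain_cycle k : chain_eq (bd (h k)) (sphere_chain k) ->
  chain_eq (bd (sphere_chain k.+1)) [::].
Proof.
move=> hk Phi; rewrite /= bd_cat ev_cat bd_map hk.
by rewrite (chain_eq_map nu hk) sphere_chain_anti addbb /ev big_nil.
Qed.

End SphereChain.

(** * Alternating simplices *)

Fixpoint altseq (b : bool) (s : seq bool) : bool :=
  if s is x :: s' then (x == b) && altseq (~~ b) s' else true.

(** A nonempty word alternating from [b] has one facet alternating from [b], obtained by dropping
    the last letter; for a word alternating from [~~ b] it is obtained by dropping the first. Any
    other word has either no such facet or two, from deleting one of two equal neighbors. *)
Lemma altseq_faces b s :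
  ev (altseq b) (faces s) = altseq b s (+) altseq (~~ b) s.
Proof.
elim: s b => [|x s IH] b; first by rewrite /ev big_nil.
have addbC3 c1 c2 : c1 (+) (c2 (+) c1) = c2 (+) false.
  by rewrite addbC -addbA addbb.
rewrite ev_faces_cons; case: x b => [] [] /=.
- by rewrite IH addbC3.
- by rewrite /ev big1_eq addbF.
- by rewrite /ev big1_eq addbF.
- by rewrite IH addbC3.
Qed.

Lemma altseq_count b s :
  altseq b s -> count_mem b s = (count_mem (~~ b) s + odd (size s))%N.
Proof.
elim: s b => [//|x s IH] b /= /andP[/eqP -> /IH].
rewrite negbK eqxx; case: b => /= ->; lia.
Qed.

Lemma altseq_negb b s : altseq b (map negb s) = altseq (~~ b) s.
Proof. by elim: s b => [//|x s IH] b /=; rewrite IH; case: x; case: b. Qed.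

Section Alternation.
Variables (V : finType) (col : V -> nat).
Local Notation T := (V * bool)%type.
Implicit Types (x y : T) (w u : seq T).

(* Colors come first; the rank only serves to break ties. *)
Definition vkey (v : V) : nat := (col v * #|V| + enum_rank v)%N.

(** The last bit separates the two copies of a vertex, which makes [le_key] antisymmetric and the
    sorted word independent of the order of the input. *)
Definition key x : nat := (vkey x.1 * 2 + x.2)%N.

Definition le_key x y := (key x <= key y)%N.

Definition alt b w := altseq b (map snd (sort le_key w)).

(** Fan's condition that no edge carries opposite labels, a label being a color whose sign is the
    copy. *)
Definition sign_separated w :=
  {in w &, forall x y, x.2 != y.2 -> col x.1 != col y.1}.

Lemma le_key_total : total le_key.
Proof. by move=> x y; exact: leq_total. Qed.

Lemma le_key_trans : transitive le_key.
Proof. by move=> y x z; exact: leq_trans. Qed.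

Lemma vkey_inj : injective vkey.
Proof.
move=> u v E; have ru := ltn_ord (enum_rank u).
have rv := ltn_ord (enum_rank v); apply/enum_rank_inj/val_inj => /=.
rewrite -(modn_small ru) -(modn_small rv) -(modnMDl (col u)).
by rewrite -(modnMDl (col v) (enum_rank v)) -!/(vkey _) E.
Qed.

Lemma key_inj : injective key.
Proof.
move=> [u b] [v b']; rewrite /key /= => E.
have Eb : b = b' by have := congr1 odd E; rewrite !oddD !oddM !andbF !oddb.
move: E; rewrite Eb => /addIn/eqP; rewrite eqn_pmul2r // => /eqP.
by move=> /vkey_inj ->.
Qed.

Lemma le_key_anti : antisymmetric le_key.
Proof. by move=> x y; rewrite -eqn_leq => /eqP/key_inj. Qed.

Lemma le_key_col x y : le_key x y -> (col x.1 <= col y.1)%N.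
Proof.
rewrite /le_key /key => h.
have : (vkey x.1 <= vkey y.1)%N by move: h; case: (x.2); case: (y.2) => /=; lia.
rewrite /vkey => {}h; have ry := ltn_ord (enum_rank y.1).
rewrite leqNgt; apply/negP => h'.
have := leq_trans (leq_mul h' (leqnn _)) (leq_trans (leq_addr _ _) h).
by rewrite mulSn addnC leq_add2l leqNgt ry.
Qed.

Lemma alt_perm b w u : perm_eq w u -> alt b w = alt b u.
Proof.
move=> /(perm_sortP le_key_total le_key_trans le_key_anti) E.
by rewrite /alt E.
Qed.

(** Facets of a sorted word are sorted, so their sign sequences are the facets of its sign sequence
    and [altseq_faces] applies. *)
Lemma alt_faces b w : ev (alt b) (faces w) = alt b w (+) alt (~~ b) w.
Proof.
have [sw ss] : perm_eq w (sort le_key w) /\ sorted le_key (sort le_key w).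
  by rewrite perm_sym perm_sort sort_sorted //; exact: le_key_total.
rewrite (ev_faces_perm (@alt_perm b) sw).
rewrite /alt -altseq_faces faces_map ev_map; apply: eq_ev_in => u uw.
congr altseq; congr map; apply: sorted_sort; first exact: le_key_trans.
exact: subseq_sorted le_key_trans _ _ (faces_subseq uw) ss.
Qed.

(** A sign-separated word never contains both copies of a vertex, so the swap preserves the key
    order and only negates the signs. *)
Lemma alt_swap b w :
  sign_separated w -> alt b (map (@swap_copies V) w) = alt (~~ b) w.
Proof.
move=> sw; rewrite /alt -altseq_negb -!map_comp.
rewrite (homo_sort_map_in (P := mem w) (leT := le_key)).
- by congr altseq; rewrite -map_comp; apply: eq_map => -[].
- by move=> x y _ _ /le_key_anti /(inv_inj (@swap_copiesK V)).
- by move=> y x z _ _ _; exact: le_key_trans.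
- by move=> x y _ _; exact: le_key_total.
- move=> [u b1] [v b2] xw yw; rewrite /le_key /key /swap_copies /=.
  have [H /=|ne] := eqVneq u v.
    suff /eqP -> : b1 == b2 by rewrite H.
    by apply/negPn/negP => /(sw _ _ xw yw); rewrite /= H eqxx.
  have : vkey u != vkey v by apply: contra_neq ne => /vkey_inj.
  by case: b1 {xw}; case: b2 {yw} => /=; lia.
by apply/allP.
Qed.

(** Neighbors in the sorted word have opposite signs, hence different colors by separation. *)
Lemma alt_strict b w : sign_separated w -> alt b w ->
  sorted ltn (map (fun x => col x.1) (sort le_key w)).
Proof.
move=> sw; rewrite /alt; have sS : {subset sort le_key w <= w}.
  by move=> x; rewrite mem_sort.
move: (sort_sorted le_key_total w).
elim: (sort le_key w) b sS => [//|x [//|y u] IH] b sS.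
move=> /= /andP[lexy su] /and3P[/eqP xb /eqP yb au].
rewrite ltn_neqAle le_key_col // sw ?sS ?inE ?eqxx ?orbT //=; last first.
  by rewrite xb yb; case: (b).
apply: (IH (~~ b)) => //=; last by rewrite yb eqxx.
by move=> z zu; apply: sS; rewrite inE zu orbT.
Qed.

End Alternation.

(** * Fan's parity argument in the box complex *)

Section BoxComplexPaths.
Variables (V : finType) (e : rel V) (C : eqType) (c : V -> C).
Hypotheses (e_sym : symmetric e) (e_irr : irreflexive e).
Hypothesis c_proper : proper_coloring e c.
Local Notation T := (V * bool)%type.
Local Notation swap := (@swap_copies V).
Local Notation box := (box_complex e).
Implicit Types (S : {set T}) (w : seq T).

(** Fan's argument needs an order on the colors; positions in a list of the colors in use provide
    one. *)
Definition color_index (v : V) : nat := index (c v) (undup [seq c u | u : V]).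
Local Notation alt := (alt color_index).
Local Notation sign_separated := (sign_separated color_index).

Definition side (b : bool) S : {set V} := [set v | (v, b) \in S]%SET.

Lemma color_indexE u v : (color_index u == color_index v) = (c u == c v).
Proof.
have cP x : c x \in undup [seq c u | u : V].
  by rewrite mem_undup map_f // mem_enum.
apply/eqP/eqP => [E|E]; last by rewrite /color_index E.
rewrite -(nth_index (c u) (cP u)) -(nth_index (c u) (cP v)).
by rewrite -!/(color_index _) E.
Qed.

Lemma box_complexP S :
  reflect (forall u v, (u, false) \in S -> (v, true) \in S -> e u v)
          (S \in box).
Proof.
apply: (iffP idP) => [/imsetP[[A B]]|H].
  rewrite inE /= => /andP[_ cAB ->] u v; rewrite !inE /= !andbT !andbF orbF.
  by move=> uA vB; move/forall_inP: cAB => /(_ u uA)/forall_inP; exact.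
apply/imsetP; exists (side false S, side true S); rewrite ?inE /=.
  apply/andP; split.
    rewrite disjoint_subset; apply/fintype.subsetP => v; rewrite !inE => vF.
    by apply/negP => vT; have := H _ _ vF vT; rewrite e_irr.
  apply/forall_inP => u; rewrite inE => uF.
  by apply/forall_inP => v; rewrite inE => vT; exact: H.
by apply/setP => -[v b]; rewrite !inE /=; case: b; rewrite ?andbT ?andbF ?orbF.
Qed.

Lemma box_complex_sub S S' : S \subset S' -> S' \in box -> S \in box.
Proof.
move=> /fintype.subsetP SS' /box_complexP H; apply/box_complexP => u v.
move=> /SS' uS /SS'; exact: H.
Qed.

Lemma box_complex_swap S : S \in box -> swap @: S \in box.
Proof. exact: swap_copies_simplex. Qed.

Lemma swap_setK S : swap @: (swap @: S) = S.
Proof.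
rewrite -imset_comp -[RHS]imset_id; apply: eq_imset => x.
exact: swap_copiesK.
Qed.

(** Vertices of a simplex lying in opposite copies are adjacent in the graph, so a proper coloring
    separates them. *)
Lemma box_separated S w : S \in box -> {subset w <= S} -> sign_separated w.
Proof.
move=> /box_complexP H wS [u b] [v b'] /wS uS /wS vS /=.
rewrite color_indexE; case: b b' uS vS => [] [] // uS vS _.
  by rewrite eq_sym; apply/c_proper/H.
exact/c_proper/H.
Qed.

Definition altset S := alt false (enum S) || alt true (enum S).

Lemma alt_uniq_col b w : sign_separated w -> alt b w ->
  uniq (map (fun x => color_index x.1) w).
Proof.
move=> sw aw.
rewrite -(perm_uniq (perm_map _ (permEl (perm_sort (le_key color_index) w)))).
exact: sorted_uniq ltn_trans ltnn _ (alt_strict sw aw).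
Qed.

Lemma alt_uniq b w : sign_separated w -> alt b w -> uniq w.
Proof. by move=> sw aw; exact: map_uniq (alt_uniq_col sw aw). Qed.

Lemma perm_enum_seq w : uniq w -> perm_eq (enum [set x in w]%SET) w.
Proof.
move=> uw; apply: uniq_perm; rewrite ?enum_uniq // => x.
by rewrite mem_enum inE.
Qed.

Lemma alt_altset b w : sign_separated w -> alt b w -> altset [set x in w]%SET.
Proof.
move=> sw aw; have pw := perm_enum_seq (alt_uniq sw aw).
by rewrite /altset !(alt_perm _ _ pw); case: b aw => ->; rewrite ?orbT.
Qed.

Lemma card_seq_set w : uniq w -> #|[set x in w]%SET| = size w.
Proof. by move=> uw; rewrite cardE (perm_size (perm_enum_seq uw)). Qed.

Lemma swap_seq_set w : [set x in map swap w]%SET = swap @: [set x in w]%SET.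
Proof.
apply/setP => x; rewrite inE; apply/mapP/imsetP => -[y yw ->]; exists y => //.
  by rewrite inE.
by move: yw; rewrite inE.
Qed.

Lemma altset_swap S : S \in box -> altset S -> altset (swap @: S).
Proof.
move=> bS; have sS : sign_separated (enum S).
  by apply: (box_separated bS) => x; rewrite mem_enum.
have pS : perm_eq (enum (swap @: S)) (map swap (enum S)).
  apply: uniq_perm; rewrite ?enum_uniq ?map_inj_uniq ?enum_uniq //.
    exact: inv_inj (@swap_copiesK V).
  move=> x; rewrite mem_enum; apply/imsetP/mapP => -[y yS ->]; exists y => //.
    by rewrite mem_enum.
  by move: yS; rewrite mem_enum.
by rewrite /altset !(alt_perm _ _ pS) !alt_swap //= orbC.
Qed.

Lemma card_side b S : #|side b S| = count_mem b (map snd (enum S)).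
Proof.
rewrite -(card_imset (side b S) (f := fun v => (v, b))); last by move=> u v [].
rewrite count_map cardE -size_filter; apply: perm_size; apply: uniq_perm.
- exact: enum_uniq.
- exact/filter_uniq/enum_uniq.
move=> [v b']; rewrite mem_enum mem_filter mem_enum /=.
apply/imsetP/andP => [[u]|[/eqP ->] vS].
  by rewrite inE => uS [-> ->].
by exists v; rewrite ?inE.
Qed.

Lemma card_sides S : (#|side false S| + #|side true S|)%N = #|S|.
Proof.
rewrite !card_side cardE -(size_map snd); elim: (map _ _) => //= b s <-.
by case: b => /=; lia.
Qed.

Lemma altset_balanced S : altset S ->
  (#|side false S| <= #|side true S| + 1)%N /\
  (#|side true S| <= #|side false S| + 1)%N.
Proof.
have cnt b : alt b (enum S) ->
    #|side b S| = (#|side (~~ b) S| + odd #|S|)%N.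
  move=> /altseq_count; rewrite size_map size_sort -cardE !card_side.
  by rewrite !(permP (perm_map snd (permEl (perm_sort _ (enum S))))).
by move=> /orP[] /cnt /=; case: odd; lia.
Qed.

Lemma altset_colors S : S \in box -> altset S ->
  (#|S| <= ncolors c (side false S :|: side true S))%N.
Proof.
move=> bS aS; have sS : sign_separated (enum S).
  by apply: (box_separated bS) => x; rewrite mem_enum.
have : uniq (map (fun x => color_index x.1) (enum S)).
  by case/orP: aS; exact: alt_uniq_col.
rewrite -[map _ _]/(map ((index^~ (undup [seq c u | u : V])) \o
   (fun x => c x.1)) _) map_comp => /map_uniq uS.
rewrite cardE -(size_map (fun x => c x.1)).
apply: uniq_leq_size => // _ /mapP[[v b] vS ->]; rewrite mem_undup /=.
apply: (map_f c); rewrite mem_enum; move: vS; rewrite mem_enum !inE.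
by case: b => ->; rewrite ?orbT.
Qed.

Variable d : nat.

(** Bounding the size by [d.+1], instead of fixing it, makes the shared facet itself a node and
    admits the sets of words with repeated letters. *)
Definition adj S S' := [&& S \in box, S' \in box, (#|S| <= d.+1)%N,
  (#|S'| <= d.+1)%N & [exists F : {set T},
   [&& altset F, #|F| == d, F \subset S & F \subset S']]].

Lemma adj_sym : symmetric adj.
Proof.
suff H S S' : adj S S' -> adj S' S by move=> S S'; apply/idP/idP; exact: H.
move=> /and5P[bS bS' cS cS' /existsP[F /and4P[aF cF FS FS']]].
apply/and5P; split => //; apply/existsP; exists F; exact/and4P.
Qed.

Lemma adj_swap S S' : adj S S' -> adj (swap @: S) (swap @: S').
Proof.
move=> /and5P[bS bS' cS cS' /existsP[F /and4P[aF cF FS FS']]].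
have swI := inv_inj (@swap_copiesK V).
apply/and5P; split; rewrite ?card_imset ?box_complex_swap //.
apply/existsP; exists (swap @: F); apply/and4P; split; rewrite ?card_imset //.
- exact: altset_swap (box_complex_sub FS bS) aF.
- exact: imsetS.
- exact: imsetS.
Qed.

Lemma adj_connect_swap S S' :
  connect adj S S' -> connect adj (swap @: S) (swap @: S').
Proof.
move=> /connectP[p pp ->]; apply/connectP.
exists (map (fun A : {set T} => swap @: A) p).
  elim: p S pp => [//|S1 p IH] S /= /andP[a pp].
  by rewrite adj_swap //=; exact: IH.
by rewrite (last_map (fun A : {set T} => swap @: A)).
Qed.

Variable h : nat -> seq (seq T).
Hypothesis h_box : forall k w, (k <= d)%N -> w \in h k ->
  [set x in w]%SET \in box /\ size w = k.+1.
Hypothesis h_bd : forall k, (k <= d)%N ->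
  chain_eq (bd (h k)) (sphere_chain swap h k).

Lemma h_separated k w : (k <= d)%N -> w \in h k -> sign_separated w.
Proof.
by move=> kd /(h_box kd)[bw _]; apply: (box_separated bw) => x xw; rewrite inE.
Qed.

(** Fan's induction. By [alt_swap], positive alternating words of the sphere correspond to words of
    [h k] alternating from either sign. By [alt_faces] their parity is that of the positive
    alternating facets of [h k], that is, of the words of the lower sphere. The empty word starts
    the induction. *)
Lemma fan_parity k : (k <= d.+1)%N -> ev (alt true) (sphere_chain swap h k).
Proof.
elim: k => [_|k IH kd]; first by rewrite /ev big_cons big_nil.
rewrite /= ev_cat ev_map -ev_split.
rewrite (eq_ev_in (Phi2 := fun w => ev (alt true) (faces w))).
  by rewrite -ev_bind h_bd // IH // ltnW.
by move=> w wh; rewrite alt_faces alt_swap //; exact: h_separated wh.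
Qed.

Lemma connected_antipodal_altset :
  exists S, [/\ S \in box, #|S| = d.+1, altset S & connect adj S (swap @: S)].
Proof.
case: (boolP [exists S : {set T}, [&& S \in box, #|S| == d.+1, altset S
    & connect adj S (swap @: S)]]) => [/existsP[S /and4P[? /eqP ? ? ?]]|].
  by exists S.
move=> /existsPn noS; exfalso.
have symC : connect_sym adj := sym_connect_sym adj_sym.
(* Of a component and its antipode, [U] selects the one whose root has the smaller rank; a component
   that is its own antipode is not selected. *)
pose rk S : nat := enum_rank (fingraph.root adj S).
pose U S := (rk S < rk (swap @: S))%N.
have U_connect S S' : connect adj S S' -> U S = U S'.
  move=> SS'; rewrite /U /rk.
  move: (SS') (adj_connect_swap SS').
  by rewrite -!(root_connect symC) => /eqP -> /eqP ->.
have U_face w u : [set x in w]%SET \in box -> size w = d.+1 -> u \in faces w ->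
    alt true u -> U [set x in u]%SET = U [set x in w]%SET.
  move=> bw sw uw au; apply/U_connect/connect1.
  have su : size u = d by have := size_faces uw; rewrite sw => -[].
  have uSw : [set x in u]%SET \subset [set x in w]%SET.
    apply/fintype.subsetP => x; rewrite !inE.
    exact: mem_subseq (faces_subseq uw) _.
  have bu := box_complex_sub uSw bw.
  have sepu : sign_separated u by apply: (box_separated bu) => x; rewrite inE.
  have cu : #|[set x in u]%SET| = d.
    by rewrite card_seq_set // (alt_uniq sepu au).
  apply/and5P; split; rewrite ?cu //.
    by rewrite -sw cardsE card_size.
  apply/existsP; exists [set x in u]%SET; rewrite (alt_altset sepu au) cu.
  by rewrite eqxx fintype.subxx uSw.
(* The words in question have [d.+1] letters, so they cannot alternate from both signs and the
   exclusive or is a disjunction. *)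
pose full w := alt true w (+) alt false w.
have ev_w w : [set x in w]%SET \in box -> size w = d.+1 ->
    ev (fun u => alt true u && U [set x in u]%SET) (faces w)
    = full w && U [set x in w]%SET.
  move=> bw sw.
  rewrite (eq_ev_in (Phi2 := fun u => alt true u && U [set x in w]%SET)).
    rewrite /full -(alt_faces _ true); case: (U _).
      by rewrite andbT; apply: eq_ev => u; rewrite andbT.
    by rewrite andbF /ev big1 // => u _; rewrite andbF.
  by move=> u uw; case: (boolP (alt true u)) => //= au; rewrite (U_face w).
(* The top sphere is a cycle, so it has evenly many positive alternating facets in [U]. Summed over
   antipodal pairs, the same count becomes the number of alternating words of [h d], which is
   odd. *)
have := sphere_chain_cycle (@swap_copiesK V) (h_bd (leqnn d))
  (fun u => alt true u && U [set x in u]%SET).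
rewrite /= bd_cat ev_cat bd_map ev_map !ev_bind -ev_split.
rewrite (eq_ev_in (Phi2 := full)) ?[ev _ [::]]big_nil.
  rewrite (eq_ev_in (Phi2 := fun w => ev (alt true) (faces w))).
    by rewrite -ev_bind h_bd // fan_parity.
  by move=> w _; rewrite alt_faces.
move=> w wh; have [bw sw] := h_box (leqnn d) wh.
have sepw := h_separated (leqnn d) wh.
rewrite /= ev_w // -[X in _ (+) X](ev_map swap
  (fun u => alt true u && U [set x in u]%SET)).
rewrite -faces_map ev_w ?swap_seq_set ?box_complex_swap ?size_map //.
have -> : full (map swap w) = full w.
  by rewrite /full !alt_swap // addbC.
case fw: (full w) => //=.
have {fw}[b aw] : exists b, alt b w.
  by move: fw; rewrite /full; case E: (alt true w); [exists true|exists false].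
(* By [noS] an alternating simplex and its antipode lie in different components, so the root ranks
   differ and [U] contains exactly one of the two. *)
have := noS [set x in w]%SET; rewrite bw card_seq_set ?(alt_uniq sepw aw) //.
rewrite sw eqxx (alt_altset sepw aw) /= -(root_connect symC) /U swap_setK.
rewrite /rk; case: ltngtP => //.
by move=> /val_inj/enum_rank_inj ->; rewrite eqxx.
Qed.

End BoxComplexPaths.

(** * From a path of simplices to the sequence of subgraphs *)

Lemma distn_leq (m n k : nat) :
  (m <= n + k)%N -> (n <= m + k)%N -> (`| m - n | <= k)%N.
Proof.
move=> mn nm; case: (leqP m n) => [le|/ltnW le].
  by rewrite distnEr //; lia.
by rewrite distnEl //; lia.
Qed.

Section AlternatingPaths.
Variables (V : finType) (e : rel V) (C : eqType) (c : V -> C).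
Hypotheses (e_sym : symmetric e) (e_irr : irreflexive e).
Hypothesis c_proper : proper_coloring e c.
Variable d : nat.
Local Notation T := (V * bool)%type.
Local Notation swap := (@swap_copies V).
Local Notation box := (box_complex e).
Local Notation adj := (adj e c d).
Local Notation altset := (altset c).
Implicit Types (S : {set T}).

Definition adj_top : rel {set T} :=
  fun S S' => [&& adj S S', #|S| == d.+1 & #|S'| == d.+1].

(** A smaller node on the path has exactly [d] vertices, so it equals the alternating facet it
    shares with each of its neighbors. These neighbors are then adjacent to each other, and the node
    can be skipped. *)
Lemma adj_top_connect S S' : #|S| = d.+1 -> #|S'| = d.+1 ->
  connect adj S S' -> connect adj_top S S'.
Proof.
move=> cS cS' /connectP[p + E]; rewrite {}E in cS' *; move: cS'.
have [n] := ubnP (size p); elim: n S p cS => // n IH S [|S1 p] cS /= sp.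
  by rewrite connect0.
move=> cS' /andP[SS1 pp].
have [cS1|nS1] := eqVneq #|S1| d.+1.
  apply: (connect_trans (y := S1)); first apply: connect1.
    by rewrite /adj_top SS1 cS cS1 eqxx.
  by apply: IH.
case: p sp pp cS' => [|S2 p] /= sp pp cS'; first by rewrite cS' eqxx in nS1.
move: pp => /andP[S1S2 pp]; apply: (IH S (S2 :: p)) => //=; rewrite ?pp ?andbT.
move: SS1 => /and5P[bS bS1 lS lS1 /existsP[F1 /and4P[aF1 /eqP cF1 F1S F1S1]]].
move: S1S2 => /and5P[_ bS2 _ lS2 /existsP[F2 /and4P[_ /eqP cF2 F2S1 F2S2]]].
have le1 : (#|S1| <= d)%N by rewrite -ltnS ltn_neqAle nS1.
have E1 : F1 = S1 by apply/eqP; rewrite eqEcard F1S1 cF1.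
have E2 : F2 = S1 by apply/eqP; rewrite eqEcard F2S1 cF2.
apply/and5P; split => //; apply/existsP; exists F1.
by rewrite aF1 cF1 eqxx F1S E1 -E2.
Qed.

(** The intersection contains a facet with [d] vertices and, the two sets being distinct of size
    [d.+1], has no more than that. *)
Lemma card_adj_top S S' : adj_top S S' -> S != S' -> #|S :\: S'| = 1%N.
Proof.
move=> /and3P[/and5P[_ _ _ _ /existsP[F /and4P[_ /eqP cF FS FS']]]].
move=> /eqP cS /eqP cS' ne.
have le1 : (d <= #|S :&: S'|)%N.
  by rewrite -cF subset_leq_card // finset.subsetI FS FS'.
have : (#|S :&: S'| < d.+1)%N.
  rewrite ltn_neqAle -{2}cS subset_leq_card ?finset.subsetIl // andbT.
  apply: contra ne => /eqP cI; have EI : S :&: S' = S.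
    by apply/eqP; rewrite eqEcard finset.subsetIl cI cS leqnn.
  by rewrite -EI eqEcard finset.subsetIr cI cS' leqnn.
have := cardsID S' S; rewrite cS; lia.
Qed.

Lemma adj_topC S S' : adj_top S S' = adj_top S' S.
Proof. by rewrite /adj_top adj_sym [(#|S| == _) && _]andbC. Qed.

Lemma side_disjoint S : S \in box -> [disjoint side false S & side true S].
Proof.
move=> /(box_complexP e_irr) H.
rewrite disjoint_subset; apply/fintype.subsetP => v; rewrite !inE => vF.
by apply/negP => vT; have := H _ _ vF vT; rewrite e_irr.
Qed.

Lemma side_complete S : S \in box ->
  complete_bip e (side false S) (side true S).
Proof.
move=> /(box_complexP e_irr) H; apply/forall_inP => u; rewrite inE => uF.
by apply/forall_inP => v; rewrite inE => vT; exact: H.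
Qed.

Lemma card_sideU S : S \in box -> #|side false S :|: side true S| = #|S|.
Proof.
move=> /side_disjoint dS; rewrite -card_sides; apply/eqP.
by rewrite (leq_card_setU _ _).2.
Qed.

Lemma side_sub b S S' : S \subset S' -> side b S \subset side b S'.
Proof.
move=> /fintype.subsetP SS'; apply/fintype.subsetP => v; rewrite !inE.
exact: SS'.
Qed.

Lemma ncolors_sub (X Y : {set V}) : X \subset Y ->
  (ncolors c X <= ncolors c Y)%N.
Proof.
move=> /fintype.subsetP XY; apply: uniq_leq_size; first exact: undup_uniq.
move=> a; rewrite !mem_undup => /mapP[v]; rewrite mem_enum => /XY vY ->.
by rewrite map_f // mem_enum.
Qed.

Lemma ncolors_card (X : {set V}) : (ncolors c X <= #|X|)%N.
Proof. by rewrite cardE -(size_map c) size_undup. Qed.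

Lemma card_side_diff S S' :
  (#|side false S :\: side false S'| + #|side true S :\: side true S'|)%N
  = #|S :\: S'|.
Proof.
have sideD b : side b S :\: side b S' = side b (S :\: S').
  by apply/setP => v; rewrite !inE.
by rewrite !sideD card_sides.
Qed.

Lemma side_swap b S : side b (swap @: S) = side (~~ b) S.
Proof.
apply/setP => v; rewrite !inE -[X in X = _]/((v, b) \in _).
rewrite -[(v, b)](@swap_copiesK V) mem_imset //.
exact: inv_inj (@swap_copiesK V).
Qed.

(** What every simplex on the path retains: its alternating facet has [d] colors and is balanced up
    to 1, and the one remaining vertex raises the imbalance to at most 2. *)
Definition near_alternating S := [/\ S \in box, #|S| = d.+1 &
  exists F : {set T}, [/\ altset F, #|F| = d & F \subset S]].

Lemma adj_top_near S S' : adj_top S S' -> near_alternating S.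
Proof.
move=> /and3P[/and5P[bS _ _ _ /existsP[F /and4P[aF /eqP cF FS _]]] /eqP cS _].
by split=> //; exists F.
Qed.

Lemma near_alternating_balanced S : near_alternating S ->
  (`| #|side false S| - #|side true S| | <= 2)%N.
Proof.
move=> [bS cS [F [aF cF FS]]].
have [l1 l2] := altset_balanced aF.
have m1 := subset_leq_card (side_sub false FS).
have m2 := subset_leq_card (side_sub true FS).
have sF := card_sides F; have sS := card_sides S.
by apply: distn_leq; lia.
Qed.

Lemma near_alternating_colors S : near_alternating S ->
  (d <= ncolors c (side false S :|: side true S))%N.
Proof.
move=> [bS cS [F [aF cF FS]]]; rewrite -cF.
have bF := box_complex_sub e_irr FS bS.
apply: leq_trans (altset_colors e_irr c_proper bF aF) _.
by apply: ncolors_sub; apply: finset.setUSS; exact: side_sub.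
Qed.

(** The sequence lists the two sides of each simplex on the path; the last simplex is the antipode
    of the first, which exchanges the sides. *)
Lemma antipodal_path S : S \in box -> #|S| = d.+1 -> altset S ->
  connect adj S (swap @: S) ->
  exists (s : nat) (A B : nat -> {set V}),
    (1 <= s)%N /\
    (forall i : nat, (1 <= i <= s)%N -> [disjoint A i & B i]) /\
    A 1%N = B s /\ A s = B 1%N /\
    (`| #|A 1%N| - #|B 1%N| | <= 1)%N /\
    ncolors c (A 1%N :|: B 1%N) = d.+1 /\
    (forall i : nat, (1 <= i <= s)%N -> complete_bip e (A i) (B i)) /\
    (forall i : nat, (1 <= i <= s)%N -> #|A i :|: B i| = d.+1) /\
    (forall i : nat, (1 <= i <= s - 1)%N ->
       (#|A i :\: A i.+1| + #|B i :\: B i.+1|)%N = 1%N /\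
       (#|A i.+1 :\: A i| + #|B i.+1 :\: B i|)%N = 1%N) /\
    (forall i : nat, (1 <= i <= s)%N -> (`| #|A i| - #|B i| | <= 2)%N) /\
    (forall i : nat, (1 <= i <= s)%N -> (d <= ncolors c (A i :|: B i))%N).
Proof.
move=> bS cS aS.
have cS' : #|swap @: S| = d.+1.
  by rewrite card_imset //; exact: inv_inj (@swap_copiesK V).
(* The path is made repetition-free so that consecutive simplices differ, hence exchange exactly one
   vertex. *)
move=> /(adj_top_connect cS cS')/connectP[p0 /shortenP[p pp up _] lastp].
have swapS : swap @: S != S.
  apply/eqP => E; have /card_gt0P[[v b] vS] : (0 < #|S|)%N by rewrite cS.
  have dS := side_disjoint bS.
  have vE b' : v \in side b' S.
    have [->|] := eqVneq b' b; rewrite ?inE // => nb; rewrite -E.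
    apply/imsetP; exists (v, b) => //; rewrite /swap_copies.
    by case: b b' nb {vS} => [] [].
  by move/disjointFr: dS => /(_ v (vE _)); rewrite vE.
(* Each simplex has a neighbor on the path: a predecessor, or for the first one a successor, which
   exists because [S] is not its own antipode. *)
have near i : (i <= size p)%N -> near_alternating (nth S (S :: p) i).
  case: i => [_|i ip].
    case: p pp lastp {up} => [|S1 p] /=.
      by move=> _ E; rewrite E eqxx in swapS.
    by move=> /andP[/adj_top_near].
  apply: (@adj_top_near _ (nth S (S :: p) i)); rewrite adj_topC.
  by move/(pathP S): pp; exact.
(* The pairs are numbered from 1, the entries of [S :: p] from 0. *)
pose X i := nth S (S :: p) i.-1.
have near1 i : (1 <= i <= (size p).+1)%N -> near_alternating (X i).
  by move=> /andP[i1 ip]; apply: near; rewrite -ltnS prednK.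
have lastX : X (size p).+1 = swap @: S.
  by rewrite /X /= nth_last lastp; case: (p).
exists (size p).+1, (fun i => side false (X i)), (fun i => side true (X i)).
split=> //; split; first by move=> i /near1[bX _ _]; exact: side_disjoint.
rewrite lastX !side_swap /=; do 2 split=> //.
split.
  have [l1 l2] := altset_balanced aS.
  exact: distn_leq.
split.
  apply/eqP; rewrite eqn_leq -{1}cS -(card_sideU bS) ncolors_card -cS.
  exact: altset_colors.
split; first by move=> i /near1[bX _ _]; exact: side_complete.
split; first by move=> i /near1[bX cX _]; rewrite card_sideU.
split.
  rewrite subn1 /= => -[//|i] /= ip.
  rewrite !card_side_diff.
  have a : adj_top (X i.+1) (X i.+2) by move/(pathP S): pp => /(_ i); exact.
  have ne : X i.+1 != X i.+2.
    by rewrite /X nth_uniq //= ?ltnS ?(ltnW ip) // neq_ltn ltnS leqnn.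
  by rewrite !card_adj_top // 1?eq_sym // adj_topC.
split=> i /near1; first exact: near_alternating_balanced.
exact: near_alternating_colors.
Qed.

End AlternatingPaths.

(** * Barycentric subdivision *)

Section Subdivision.
Variables (P : eqType) (b : seq P -> P).
Implicit Types (w u : seq P) (s : seq (seq P)).

(** The cone from the barycenter over the subdivided facets. Facets are not subterms of the word, so
    the recursion runs on its length. *)
Fixpoint sd_rec (n : nat) w : seq (seq P) :=
  if n is n'.+1 then map (cons (b w)) (flatten (map (sd_rec n') (faces w)))
  else [:: [::]].

Definition sd w := sd_rec (size w) w.

Definition Sd s := flatten (map sd s).

Lemma sdE x w : sd (x :: w) = map (cons (b (x :: w))) (Sd (faces (x :: w))).
Proof.
transitivity (map (cons (b (x :: w)))
    (flatten (map (sd_rec (size w)) (faces (x :: w))))); first by [].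
congr (map _ (flatten _)); apply/eq_in_map => u uw.
by have [->] := size_faces uw.
Qed.

Lemma Sd_cat s1 s2 : Sd (s1 ++ s2) = Sd s1 ++ Sd s2.
Proof. by rewrite /Sd map_cat flatten_cat. Qed.

Lemma Sd_eq s1 s2 : chain_eq s1 s2 -> chain_eq (Sd s1) (Sd s2).
Proof. by move=> E Phi; rewrite !ev_bind. Qed.

Lemma mem_Sd s u : reflect (exists2 w, w \in s & u \in sd w) (u \in Sd s).
Proof. exact: flatten_mapP. Qed.

Lemma sd_ind (Q : seq P -> Prop) : Q [::] ->
  (forall w, w != [::] -> (forall u, u \in faces w -> Q u) -> Q w) ->
  forall w, Q w.
Proof.
move=> Q0 QS w; have [n] := ubnP (size w); elim: n w => // n IH [//|x w] sw.
by apply: QS => // u uw; apply: IH; have := size_faces uw; move: sw => /=; lia.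
Qed.

(** The boundary of a cone is its base plus the cone over the boundary of the base. By induction the
    latter boundary is the subdivision of [bd (faces w)], which vanishes. *)
Lemma bd_sd w : chain_eq (bd (sd w)) (Sd (faces w)).
Proof.
elim/sd_ind: w => [//|[//|x w] _ IH] Phi.
rewrite sdE bd_cone ev_cat ev_cons.
rewrite [X in _ (+) X](_ : _ = false) ?addbF //.
set Psi := fun w => _; rewrite ev_bind {1}/Sd /ev big_flatten big_map.
rewrite (eq_big_seq (fun u => ev Psi (Sd (faces u)))).
  rewrite -[LHS]/(ev (fun u => ev Psi (Sd (faces u))) (faces (x :: w))).
  rewrite -(ev_bind Psi (fun u => Sd (faces u))).
  have -> : ev Psi (flatten [seq Sd (faces u) | u <- faces (x :: w)])
      = ev Psi (Sd (bd (faces (x :: w)))).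
    by rewrite ev_bind [RHS]ev_bind ev_bind; apply: eq_ev => u; rewrite ev_bind.
  by rewrite (Sd_eq (bd_faces (x :: w))) /ev big_nil.
by move=> u uw; rewrite -IH // ev_bind.
Qed.

Lemma bd_Sd s : chain_eq (bd (Sd s)) (Sd (bd s)).
Proof.
move=> Phi; rewrite !ev_bind; apply: eq_ev => w.
by rewrite -ev_bind bd_sd ev_bind.
Qed.

Lemma size_sd w u : u \in sd w -> size u = size w.
Proof.
elim/sd_ind: w u => [|[//|x w] _ IH] u; first by rewrite inE => /eqP ->.
rewrite sdE => /mapP[v /mem_Sd[w' w'w vw'] ->] /=.
by rewrite (IH _ w'w _ vw') -(size_faces w'w).
Qed.

(** Vertices of the subdivision are iterated barycenters; this serves for convex conditions such as
    lying in a ball or in a facet. *)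
Lemma sd_closed (Q : P -> Prop) :
  (forall w, w != [::] -> {in w, forall x, Q x} -> Q (b w)) ->
  forall w u, {in w, forall x, Q x} -> u \in sd w -> {in u, forall x, Q x}.
Proof.
move=> Qb; elim/sd_ind => [|[//|x w] _ IH] u Qw.
  by rewrite inE => /eqP ->.
rewrite sdE => /mapP[v /mem_Sd[w' w'w vw'] ->] y.
rewrite inE => /orP[/eqP ->|yv]; first exact: Qb.
apply: (IH _ w'w v) yv => // z zw'; apply: Qw.
exact: mem_subseq (faces_subseq w'w) _ zw'.
Qed.

Variable nu : P -> P.
Hypothesis b_nu : forall w, b (map nu w) = nu (b w).

Lemma sd_map w : sd (map nu w) = map (map nu) (sd w).
Proof.
elim/sd_ind: w => [//|[//|x w] _ IH].
rewrite [map nu _]/= !sdE -[_ :: map nu w]/(map nu (x :: w)) b_nu.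
rewrite -!map_comp /Sd faces_map map_flatten -map_comp -!map_comp.
rewrite map_flatten -map_comp; congr flatten; apply/eq_in_map => u uw /=.
by rewrite IH // -map_comp.
Qed.

Lemma Sd_map s : Sd (map (map nu) s) = map (map nu) (Sd s).
Proof.
rewrite /Sd map_flatten -!map_comp; congr flatten.
by apply: eq_map => w /=; exact: sd_map.
Qed.

End Subdivision.

Local Open Scope ring_scope.

(** * Mesh of the barycentric subdivision *)

Section Mesh.
Variables (R : realType) (V : normedModType R).
Implicit Types (w u : seq V) (x y : V).

Definition bary w : V := (size w)%:R^-1 *: \sum_(x <- w) x.

Lemma bary_opp w : bary (map -%R w) = - bary w.
Proof. by rewrite /bary size_map big_map sumrN scalerN. Qed.

Lemma bary_sub w a : w != [::] ->
  bary w - a = (size w)%:R^-1 *: \sum_(x <- w) (x - a).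
Proof.
move=> w0; rewrite sumrB scalerBr big_const_seq iter_addr_0 count_predT.
rewrite -(scaler_nat _ a) scalerA mulVf ?scale1r // pnatr_eq0.
by case: w w0.
Qed.

Lemma sum_norm_le w a r : {in w, forall x, `|x - a| <= r} ->
  `|\sum_(x <- w) (x - a)| <= (size w)%:R * r.
Proof.
move=> wr; apply: le_trans (ler_norm_sum _ _ _) _.
rewrite big_seq (le_trans (ler_sum _ wr)) // -big_seq.
by rewrite big_const_seq iter_addr_0 count_predT mulr_natl.
Qed.

Lemma bary_dist w a r : w != [::] -> {in w, forall x, `|x - a| <= r} ->
  `|bary w - a| <= r.
Proof.
move=> w0 wr; rewrite bary_sub // normrZ normfV normr_nat.
have s0 : (0 < size w)%N by case: w w0 {wr}.
by rewrite ler_pdivrMl ?ltr0n // sum_norm_le.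
Qed.

Lemma bary_diam w m r : (0 <= r) -> (size w <= m.+1)%N ->
  {in w &, forall x y, `|x - y| <= r} ->
  {in w, forall x, `|x - bary w| <= m%:R / m.+1%:R * r}.
Proof.
move=> r0 sm wr x xw; have w0 : w != [::] by case: (w) xw.
rewrite distrC bary_sub // (big_rem x) //= subrr add0r.
rewrite normrZ normfV normr_nat.
have s0 : (0 < size w)%N by case: w w0 {wr xw sm}.
have le1 : `|\sum_(y <- rem x w) (y - x)| <= (size w).-1%:R * r.
  rewrite -(size_rem xw); apply: sum_norm_le => y yw; apply: wr => //.
  exact: mem_rem yw.
rewrite ler_pdivrMl ?ltr0n // (le_trans le1) // mulrA ler_wpM2r //.
rewrite mulrA ler_pdivlMr ?ltr0n // -!natrM ler_nat.
by move: s0 sm; case: (size w) => //= n _; rewrite ltnS; nia.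
Qed.

(** A new simplex is the barycenter of the word followed by a simplex subdividing a facet. The
    latter is small by induction and stays close to the barycenter because balls are convex. *)
Lemma sd_mesh m w u r : (0 <= r) -> (size w <= m.+1)%N ->
  {in w &, forall x y, `|x - y| <= r} -> u \in sd bary w ->
  {in u &, forall x y, `|x - y| <= m%:R / m.+1%:R * r}.
Proof.
move=> r0; elim/sd_ind: w u => [|[//|x w] _ IH] u sw wr.
  by rewrite inE => /eqP ->.
rewrite sdE => /mapP[v /mem_Sd[w' w'w vw'] ->].
have w'sub : {subset w' <= x :: w}.
  exact: mem_subseq (faces_subseq w'w).
have diam := bary_diam r0 sw wr.
set c := bary (x :: w) in diam *; set q := _ * r in diam *.
have q0 : 0 <= q by rewrite /q mulr_ge0 // divr_ge0.
have vc : {in v, forall y, `|y - c| <= q}.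
  apply: sd_closed vw' => [w1 w1n|y /w'sub]; last exact: diam.
  exact: bary_dist.
have vv : {in v &, forall y z, `|y - z| <= q}.
  apply: (IH w' w'w v) => //.
    by rewrite (leq_trans _ sw) // (size_faces w'w).
  by move=> y z /w'sub yw /w'sub; exact: wr.
move=> y z; rewrite !inE => /orP[/eqP ->|yv] /orP[/eqP ->|zv].
- by rewrite subrr normr0.
- by rewrite distrC; exact: vc.
- exact: vc.
- exact: vv.
Qed.

End Mesh.

Section IterSubdivision.
Variables (P : eqType) (b : seq P -> P) (N : nat).
Implicit Types (s : seq (seq P)).

Lemma iter_Sd_eq s1 s2 :
  chain_eq s1 s2 -> chain_eq (iter N (Sd b) s1) (iter N (Sd b) s2).
Proof. by move=> E; elim: N => //= n IH; exact: Sd_eq. Qed.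

Lemma bd_iter_Sd s : chain_eq (bd (iter N (Sd b) s)) (iter N (Sd b) (bd s)).
Proof.
elim: N => [//|n IH] Phi; rewrite [in LHS]iterS bd_Sd iterS; exact: Sd_eq.
Qed.

Lemma iter_Sd_sphere_chain (nu : P -> P) h k :
  (forall w, b (map nu w) = nu (b w)) ->
  iter N (Sd b) (sphere_chain nu h k) =
  sphere_chain nu (fun k => iter N (Sd b) (h k)) k.
Proof.
move=> bnu; case: k => [|k] /=; elim: N => //= n ->; rewrite ?Sd_cat ?Sd_map //.
Qed.

End IterSubdivision.

(** * Triangulated hemispheres of the cross-polytope *)

Section CrossPolytope.
Variables (R : realType) (d : nat).
Local Notation P := 'rV[R]_d.+1.
Implicit Types (x y : P) (w : seq P) (sg : 'I_d.+1 -> bool).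

Definition crossaxis (k : nat) : P := delta_mx ord0 (inord k).

(** The boundary of the cross-polytope on the first [k] axes, of dimension [k - 1]: a cone over the
    previous sphere together with its antipode. *)
Fixpoint crosssphere (k : nat) : seq (seq P) :=
  if k is k'.+1 then
    map (cons (crossaxis k')) (crosssphere k') ++
    map (map -%R) (map (cons (crossaxis k')) (crosssphere k'))
  else [:: [::]].

Definition crosshemi (k : nat) : seq (seq P) :=
  map (cons (crossaxis k)) (crosssphere k).

Lemma crosssphereE k : crosssphere k = sphere_chain -%R crosshemi k.
Proof. by case: k. Qed.

Lemma bd_crosshemi k : chain_eq (bd (crosshemi k)) (crosssphere k).
Proof.
suff bdz : chain_eq (bd (crosssphere k)) [::].
  move=> Phi; rewrite bd_cone ev_cat ev_cons bdz.
  by rewrite /ev [X in _ (+) X]big_nil addbF.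
elim: k => [//|k IH]; rewrite crosssphereE.
apply: sphere_chain_cycle; first exact: opprK.
move=> Phi; rewrite -crosssphereE bd_cone ev_cat ev_cons IH.
by rewrite /ev [X in _ (+) X]big_nil addbF.
Qed.

(** The facet of the cross-polytope in the orthant with signs [sg]; the conditions are linear there,
    hence preserved by barycenters. *)
Definition orthant_face sg x :=
  (forall i, 0 <= (-1) ^+ sg i * x ord0 i) /\
  \sum_i (-1) ^+ sg i * x ord0 i = 1.

Lemma orthant_face_opp sg x :
  orthant_face sg x -> orthant_face (fun i => ~~ sg i) (- x).
Proof.
have E i : (-1) ^+ (~~ sg i) * (- x) ord0 i = (-1) ^+ sg i * x ord0 i.
  by rewrite mxE signrN mulrNN.
move=> [x0 x1]; split=> [i|]; first by rewrite E.
by rewrite (eq_bigr _ (fun i _ => E i)).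
Qed.

Lemma orthant_face_bary sg w : w != [::] ->
  {in w, forall x, orthant_face sg x} -> orthant_face sg (bary w).
Proof.
move=> w0 wf.
have E i : (-1) ^+ sg i * bary w ord0 i =
    (size w)%:R^-1 * \sum_(x <- w) (-1) ^+ sg i * x ord0 i.
  by rewrite mxE summxE mulrCA mulr_sumr.
split=> [i|].
  rewrite E mulr_ge0 // big_seq sumr_ge0 // => x xw.
  exact: (wf x xw).1.
rewrite (eq_bigr _ (fun i _ => E i)) -mulr_sumr exchange_big /=.
rewrite big_seq (eq_bigr (fun=> 1)) => [|x /wf[]//].
rewrite -big_seq big_const_seq iter_addr_0 count_predT mulVf //.
by rewrite pnatr_eq0; case: (w) w0.
Qed.

Lemma orthant_face_coord sg x i : orthant_face sg x -> `|x ord0 i| <= 1.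
Proof.
move=> [x0 <-]; rewrite (bigD1 i) //= -(normrMsign (sg i)).
by rewrite ger0_norm // lerDl sumr_ge0.
Qed.

Lemma orthant_face_dist sg x y :
  orthant_face sg x -> orthant_face sg y -> `|x - y| <= 2.
Proof.
move=> fx fy; rewrite [leLHS]mx_normrE; apply: bigmax_le => // -[i j] _ /=.
rewrite !mxE ord1 (le_trans (ler_normB _ _)) // -[2]/(1 + 1).
by apply: lerD; apply: orthant_face_coord; eassumption.
Qed.

Lemma orthant_face_neq0 sg x : orthant_face sg x -> x != 0.
Proof.
move=> [_ x1]; apply/eqP => x0; move: x1; rewrite x0 big1.
  by move/esym/eqP; rewrite oner_eq0.
by move=> i _; rewrite mxE mulr0.
Qed.

Lemma crosssphere_face k w : (k <= d.+1)%N -> w \in crosssphere k ->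
  size w = k /\ exists sg, {in w, forall x,
    orthant_face sg x /\ forall j : 'I_d.+1, (k <= j)%N -> x ord0 j = 0}.
Proof.
elim: k w => [|k IH] w kd.
  by rewrite inE => /eqP ->; split=> //; exists xpredT.
have hemi v : v \in crosshemi k -> size v = k.+1 /\
    exists sg, {in v, forall x,
    orthant_face sg x /\ forall j : 'I_d.+1, (k.+1 <= j)%N -> x ord0 j = 0}.
  move=> /mapP[u /(IH _ (ltnW kd))[su [sg usg]] ->].
  split; first by rewrite /= su.
  (* The new axis needs the sign [false] at position [k]; the older vertices vanish there, so their
     sign can be reset. *)
  exists (fun i => if i == inord k then false else sg i) => x.
  rewrite inE => /orP[/eqP ->|/usg[[x0 x1] xk]].
    split; last first.
      move=> j kj; rewrite mxE eqxx /=; case: eqP => // E.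
      by move: kj; rewrite E inordK // ltnn.
    have E i : (-1) ^+ (if i == inord k then false else sg i) *
        crossaxis k ord0 i = (i == inord k)%:R.
      by rewrite mxE eqxx /=; case: eqP => _; rewrite ?mulr0 ?mulr1.
    split=> [i|]; first by rewrite E ler0n.
    rewrite (eq_bigr _ (fun i _ => E i)) (bigD1 (inord k)) //= eqxx.
    by rewrite big1 ?addr0 // => i /negPf ->.
  split; last by move=> j kj; apply: xk; rewrite ltnW.
  have E i : (-1) ^+ (if i == inord k then false else sg i) * x ord0 i =
      (-1) ^+ sg i * x ord0 i.
    by case: eqP => // ->; rewrite xk ?mulr0 // inordK.
  by split=> [i|]; [rewrite E|rewrite (eq_bigr _ (fun i _ => E i))].
rewrite /= mem_cat => /orP[/hemi//|/mapP[v /hemi[sv [sg vsg]] ->]].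
split; first by rewrite size_map.
exists (fun i => ~~ sg i) => _ /mapP[x /vsg[fx xk] ->].
split; first exact: orthant_face_opp.
by move=> j /xk xj; rewrite mxE xj oppr0.
Qed.

(** One contraction factor serves all dimensions up to [d]; 2 is a crude initial bound for the
    sup-norm distance within a facet. *)
Lemma iter_Sd_crosshemi N k w : (k <= d)%N ->
  w \in iter N (Sd (@bary _ _)) (crosshemi k) ->
  [/\ size w = k.+1, exists sg, {in w, forall x, orthant_face sg x} &
      {in w &, forall x y, `|x - y| <= (d%:R / d.+1%:R) ^+ N * 2}].
Proof.
move=> kd; elim: N w => [|N IH] w /=.
  move=> wk; have : w \in crosssphere k.+1 by rewrite /= mem_cat wk.
  move=> /(crosssphere_face (k := k.+1) kd)[sw [sg wf]].
  split=> //; first by exists sg => x /wf[].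
  rewrite expr0 mul1r => x y /wf[fx _] /wf[fy _].
  exact: orthant_face_dist fx fy.
move=> /mem_Sd[v /IH[sv [sg vf] vd] wv].
have sw : size w = k.+1 by rewrite (size_sd wv).
split=> //.
  exists sg; apply: (sd_closed _ vf wv) => w1 w1n; exact: orthant_face_bary.
rewrite exprS -mulrA; apply: sd_mesh vd wv; last by rewrite sv.
by rewrite mulr_ge0 // exprn_ge0 // divr_ge0.
Qed.

(** All hemispheres are subdivided equally often. Subdivision commutes with the boundary and the
    antipode, so the boundary relations survive. *)
Lemma small_sphere_chains (r : R) : 0 < r ->
  exists h : nat -> seq (seq P),
    (forall k w, (k <= d)%N -> w \in h k ->
      [/\ size w = k.+1, exists sg, {in w, forall x, orthant_face sg x} &
          {in w &, forall x y, `|x - y| < r}]) /\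
    (forall k, chain_eq (bd (h k)) (sphere_chain -%R h k)).
Proof.
move=> r0; pose q : R := d%:R / d.+1%:R.
have [N qN] : exists N, q ^+ N * 2 < r.
  have q1 : `|q| < 1.
    by rewrite ger0_norm ?divr_ge0 // ltr_pdivrMr ?ltr0n // mul1r ltr_nat.
  have /cvgr0Pnorm_lt/(_ (r / 2)) := cvg_expr q1.
  move=> /(_ (divr_gt0 r0 (ltr0Sn R 1)))[N _ /(_ N (leqnn N)) /= qN].
  exists N; rewrite -ltr_pdivlMr ?ltr0n //; exact: le_lt_trans (ler_norm _) qN.
exists (fun k => iter N (Sd (@bary _ _)) (crosshemi k)); split.
  move=> k w kd /(iter_Sd_crosshemi kd)[sw fw dw]; split=> // x y xw yw.
  exact: le_lt_trans (dw x y xw yw) qN.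
move=> k Phi; rewrite bd_iter_Sd -iter_Sd_sphere_chain; last exact: bary_opp.
by rewrite (iter_Sd_eq _ _ (bd_crosshemi k)) crosssphereE.
Qed.

End CrossPolytope.

(** * Simplicial approximation *)

Section Normalization.
Variables (R : realType) (d : nat).
Local Notation P := 'rV[R]_d.+1.
Implicit Types (x y : P).

Definition sqnorm x : R := \sum_(i < d.+1) x ord0 i ^+ 2.

Definition normalize x : P := (Num.sqrt (sqnorm x))^-1 *: x.

Lemma sqnorm_gt0 x : x != 0 -> 0 < sqnorm x.
Proof.
move=> x0; rewrite lt_neqAle sumr_ge0 ?andbT => [|i _]; last exact: sqr_ge0.
apply: contra x0.
rewrite eq_sym psumr_eq0 => [/allP x0|i _]; last exact: sqr_ge0.
apply/eqP/rowP => i; rewrite mxE; apply/eqP.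
by have := x0 i (mem_index_enum i); rewrite sqrf_eq0.
Qed.

Lemma normalize_sphere x : x != 0 -> sphere_set (normalize x).
Proof.
move=> /sqnorm_gt0 x0; rewrite /sphere_set /=.
under eq_bigr do rewrite mxE exprMn exprVn sqr_sqrtr ?ltW //.
by rewrite -mulr_sumr mulVf // gt_eqF.
Qed.

Lemma normalizeN x : normalize (- x) = - normalize x.
Proof.
rewrite /normalize scalerN; congr (- (_^-1 *: _)); congr Num.sqrt.
by apply: eq_bigr => i _; rewrite mxE sqrrN.
Qed.

Lemma sqnorm_continuous : continuous sqnorm.
Proof.
apply: continuous_big => [|i _ x]; first exact: add_continuous.
apply: (@continuous_comp _ _ _ (fun x : P => x ord0 i) (fun r : R => r ^+ 2)).
  exact: coord_continuous.
exact: exprn_continuous.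
Qed.

Lemma normalize_continuous x : x != 0 -> {for x, continuous normalize}.
Proof.
move=> x0; apply: continuousZ; last exact: cvg_id.
apply: continuousV; first by rewrite gt_eqF // sqrtr_gt0 sqnorm_gt0.
apply: continuous_comp; first exact: sqnorm_continuous.
exact: sqrt_continuous.
Qed.

Lemma pole_neq0 : (\row_(i < d.+1) 1 : P) != 0.
Proof.
apply/eqP => /rowP/(_ ord0); rewrite !mxE => /eqP.
by rewrite oner_eq0.
Qed.

Definition pole : set_type (@sphere_set R d) :=
  exist (fun x => x \in @sphere_set R d) _
    (mem_set (normalize_sphere pole_neq0)).

(** Radial projection to the round sphere; [pole] is the default value at 0, which the
    cross-polytope avoids. *)
Definition to_sphere x : sphere R d := insubd pole (normalize x).

Lemma val_to_sphere x : x != 0 -> set_val (to_sphere x) = normalize x.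
Proof. by move=> x0; apply: insubdK; exact/mem_set/normalize_sphere. Qed.

Lemma to_sphereN x : x != 0 -> to_sphere (- x) = z2_act (to_sphere x).
Proof.
move=> x0; apply: val_inj.
by rewrite [LHS]val_to_sphere ?oppr_eq0 // normalizeN -val_to_sphere.
Qed.

Lemma to_sphere_continuous x : x != 0 -> {for x, continuous to_sphere}.
Proof.
move=> x0 U [_ [[W oW <-] /= Wx WU]].
have y_neq0 : \forall y \near x, y != 0.
  have : \forall y \near x, 0 < sqnorm y.
    exact: (@cvgr_gt _ _ _ _ _ _ (@sqnorm_continuous x) 0 (sqnorm_gt0 x0)).
  apply: filterS => y; apply: contraTneq => ->.
  by rewrite /sqnorm big1 ?ltxx // => i _; rewrite mxE expr0n.
have nW : \forall y \near x, W (normalize y).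
  apply: (normalize_continuous x0); apply: open_nbhs_nbhs; split=> //.
  by rewrite -val_to_sphere.
by apply: filterS2 y_neq0 nW => y y0 Wy; apply: WU; rewrite /= val_to_sphere.
Qed.

End Normalization.

(** * Equivariant vertex labels for points of the box complex *)

Section Labels.
Variables (R : realType) (V : finType) (e : rel V).
Hypotheses (e_irr : irreflexive e) (V_nonempty : (0 < #|V|)%N).
Local Notation T := (V * bool)%type.
Local Notation swap := (@swap_copies V).
Implicit Types (y : T -> R).

Definition mass y (v : V) : R := y (v, false) + y (v, true).

(* Since [mass] is invariant under the swap, so is the vertex it selects. *)
Definition heavy (m : V -> R) : V :=
  odflt (enum_val (Ordinal V_nonempty)) [pick v | #|V|%:R^-1 <= m v].

(** In a point of the box complex the mass of a vertex sits on a single copy, so the sign of the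
    second coordinate identifies that copy. *)
Definition lab y : T := (heavy (mass y), 0 < y (heavy (mass y), true)).

(** Pigeonhole: the masses add up to 1, so [pick] succeeds and the default vertex in [heavy] is not
    reached. *)
Lemma lab_mass y : \sum_p y p = 1 -> #|V|%:R^-1 <= mass y (heavy (mass y)).
Proof.
move=> y1; rewrite /heavy; case: pickP => [v //|no] /=; exfalso.
have : \sum_v mass y v < \sum_(v : V) #|V|%:R^-1.
  apply: ltr_sum => [|v _]; last by rewrite ltNge no.
  by apply/hasP; exists (enum_val (Ordinal V_nonempty)).
rewrite sumr_const -[_ *+ _]mulr_natr mulVf ?pnatr_eq0 -?lt0n //.
rewrite -y1 (eq_bigr (fun p => y (p.1, p.2))) => [|[]//].
rewrite -(pair_bigA _ (fun v b => y (v, b))) /=.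
rewrite [X in _ < X](eq_bigr (mass y)) ?ltxx // => v _.
by rewrite big_bool /mass /= addrC.
Qed.

Variable y : T -> R.
Hypothesis y_real : realization_set (box_complex e) y.

Lemma supp_separated v : 0 < y (v, true) -> y (v, false) = 0.
Proof.
move: y_real => [y0 y1 /(box_complexP e_irr) bx] yt.
apply/eqP; case: eqP => // /eqP yf; have := bx v v.
by rewrite !inE yf gt_eqF // e_irr => /(_ isT isT).
Qed.

Lemma lab_ge : #|V|%:R^-1 <= y (lab y).
Proof.
move: (y_real) => [y0 y1 _]; have := lab_mass y1.
rewrite /lab; set v := heavy _; rewrite /mass.
case: (ltP 0 (y (v, true))) => [/supp_separated ->|yt]; first by rewrite add0r.
by rewrite (_ : y (v, true) = 0) ?addr0 //; apply/eqP; rewrite eq_le yt y0.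
Qed.

Lemma lab_swap : lab (fun p => y (swap p)) = swap (lab y).
Proof.
have E : mass (fun p => y (swap p)) = mass y.
  by apply/funext => v; rewrite /mass addrC.
move: (y_real) => [y0 y1 _]; have := lab_mass y1.
rewrite /lab E /swap_copies /=; set v := heavy _ => mv; congr pair.
have {mv} : 0 < mass y v by apply: lt_le_trans mv; rewrite invr_gt0 ltr0n.
rewrite /mass; case: (ltP 0 (y (v, true))) => [yt _|yt].
  by rewrite supp_separated // ltxx.
have -> : y (v, true) = 0 by apply/eqP; rewrite eq_le yt y0.
by rewrite addr0 => ->.
Qed.

End Labels.

(** A Heine-Cantor argument: around each center half of the radius and half of the tolerance are
    used, and compactness makes the radius uniform. *)
Lemma compact_unif_close (R : realType) (X : normedModType R) (I : finType)
    (K : set X) (F : X -> I -> R) :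
  compact K -> (forall x, K x -> forall i, {for x, continuous (F^~ i)}) ->
  forall eps, 0 < eps -> exists2 r, 0 < r &
    forall x y, K x -> `|x - y| < r -> forall i, `|F x i - F y i| < eps.
Proof.
move=> /compact_near_coveringP Kc Fc eps eps0.
pose Q (r : R) (x : X) :=
  forall y, `|x - y| < r -> forall i, `|F x i - F y i| < eps.
have : \forall r \near 0^'+%classic, (K `<=` Q r)%classic.
  apply: Kc => x Kx.
  have : \forall y \near x, forall i, `|F x i - F y i| < eps / 2.
    apply: filter_forall => i.
    by move/cvgrPdist_lt: (Fc x Kx i); apply; rewrite divr_gt0.
  move=> /nbhs_normP[eta /= eta0 xeta].
  have e2 : 0 < eta / 2 by rewrite divr_gt0.
  exists ([set x' | `|x - x'| < eta / 2]%classic,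
          [set r | r < eta / 2]%classic).
    split; first by apply/nbhs_normP; exists (eta / 2).
    exact: nbhs_right_lt.
  move=> [x' r] /= [xx' rlt] y x'y i.
  have xy : `|x - y| < eta.
    rewrite -(subrKA x') (le_lt_trans (ler_normD _ _)) // [eta]splitr.
    by rewrite ltrD // (lt_trans x'y).
  have Fx' : `|F x i - F x' i| < eps / 2.
    apply: xeta; rewrite /= (lt_trans xx') //.
    by rewrite ltr_pdivrMr // ltr_pMr // ltr1n.
  have Fy : `|F x i - F y i| < eps / 2 by apply: xeta.
  rewrite -(subrKA (F x i)) (le_lt_trans (ler_normD _ _)) // [eps]splitr.
  by rewrite ltrD // distrC.
move=> H.
have : \forall r \near 0^'+%classic, 0 < r /\ (K `<=` Q r)%classic.
  by apply: filterS2 (nbhs_right_gt 0) H => r.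
move=> /filter_ex[r [rp Kr]]; exists r => // x y /Kr; exact.
Qed.

Section CrossPolytopeCompact.
Variables (R : realType) (d : nat).
Local Notation P := 'rV[R]_d.+1.

(** The boundary of the cross-polytope as the unit sphere of the sum norm; it contains all vertices
    of the subdivisions. *)
Definition crosspolytope : set P :=
  [set x | \sum_(i < d.+1) `|x ord0 i| = 1]%classic.

Lemma orthant_face_crosspolytope sg (x : P) :
  orthant_face sg x -> crosspolytope x.
Proof.
move=> [x0 x1]; rewrite /crosspolytope /= -[RHS]x1; apply: eq_bigr => i _.
by rewrite -(normrMsign (sg i)) ger0_norm.
Qed.

Lemma crosspolytope_neq0 (x : P) : crosspolytope x -> x != 0.
Proof.
move=> x1; apply/eqP => x0; move: x1; rewrite /crosspolytope /= x0 big1.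
  by move/esym/eqP; rewrite oner_eq0.
by move=> i _; rewrite mxE normr0.
Qed.

Lemma crosspolytope_compact : compact crosspolytope.
Proof.
apply: bounded_closed_compact.
  exists 1; split=> // M M1 x x1; rewrite /= [leLHS]mx_normrE.
  apply: bigmax_le => [|[i j] _ /=]; first by rewrite (le_trans _ (ltW M1)).
  rewrite ord1 (le_trans _ (ltW M1)) // -[leRHS]x1 (bigD1 j) //= lerDl.
  by rewrite sumr_ge0.
pose l1 (x : P) : R := \sum_(i < d.+1) `|x ord0 i|.
have -> : crosspolytope = (l1 @^-1` [set 1])%classic by [].
apply: (closed_comp (f := l1)) => [x _|]; last exact: closed_eq.
apply: continuous_big => [|i _ y]; first exact: add_continuous.
apply: (@continuous_comp _ _ _ (fun x : P => x ord0 i) (fun r : R => `|r|)).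
  exact: coord_continuous.
exact: norm_continuous.
Qed.

End CrossPolytopeCompact.

(** * Chains in the box complex from a Z2-map *)

Section Approximation.
Variables (R : realType) (V : finType) (e : rel V) (d : nat).
Hypotheses (e_sym : symmetric e) (e_irr : irreflexive e).
Hypothesis V_nonempty : (0 < #|V|)%N.
Variable f : sphere R d -> B0 e_sym R.
Hypothesis f_z2 : z2map f.
Local Notation T := (V * bool)%type.
Local Notation swap := (@swap_copies V).
Local Notation P := 'rV[R]_d.+1.

Definition coords (x : P) : T -> R := set_val (f (to_sphere x)).

Lemma coords_real x : realization_set (box_complex e) (coords x).
Proof. exact: set_valP. Qed.

Lemma coordsN x : x != 0 -> coords (- x) = fun p => coords x (swap p).
Proof. by move=> x0; rewrite /coords to_sphereN // f_z2.2. Qed.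

Lemma coords_continuous x p : x != 0 ->
  {for x, continuous (fun y => coords y p)}.
Proof.
move=> x0.
apply: (@continuous_comp _ _ _ (@to_sphere R d)
  (fun z => (set_val (f z) : T -> R) p)).
  exact: to_sphere_continuous.
apply: (@continuous_comp _ _ _ f
  (fun z : B0 e_sym R => (set_val z : T -> R) p)).
  exact: f_z2.1.
apply: (@continuous_comp _ {ptws T -> R} _ set_val (fun z => z p)).
  exact: initial_continuous.
exact: (@proj_continuous T (fun=> R)).
Qed.

Lemma box_chains : exists h : nat -> seq (seq T),
  (forall k w, (k <= d)%N -> w \in h k ->
     [set x in w]%SET \in box_complex e /\ size w = k.+1) /\
  (forall k, (k <= d)%N -> chain_eq (bd (h k)) (sphere_chain swap h k)).
Proof.
have n0 : 0 < #|V|%:R^-1 :> R by rewrite invr_gt0 ltr0n.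
(* The tolerance [1 / #|V|] matches the lower bound [lab_ge] for the coordinate at a label. *)
have [r r0 Fr] := compact_unif_close (@crosspolytope_compact R d)
  (fun x Lx p => coords_continuous (p := p) (crosspolytope_neq0 Lx)) n0.
have [h [hP hbd]] := small_sphere_chains d r0.
pose g x := lab V_nonempty (coords x).
exists (fun k => map (map g) (h k)); split.
  move=> k _ kd /mapP[w wh ->]; have [sw [sg fw] dw] := hP k w kd wh.
  split; last by rewrite size_map.
  case: w sw wh fw dw => // x0 w _ _ fw dw.
  (* All labels lie in the support at the first point [x0]: the coordinate at the label of [x] is at
     least [1 / #|V|] at [x] and changes by less, so it is positive at [x0]. *)
  have [y0 y1 bx] := coords_real x0.
  apply: box_complex_sub bx => //; apply/fintype.subsetP => p.
  rewrite !finset.in_set => /mapP[x xw ->]; rewrite gt_eqF //.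
  have := Fr x x0 (orthant_face_crosspolytope (fw x xw)).
  move=> /(_ (dw x x0 xw (mem_head _ _)) (g x)).
  rewrite ltr_norml => /andP[_]; rewrite ltrBlDr => /(le_lt_trans _).
  move=> /(_ _ (lab_ge e_irr V_nonempty (coords_real x))).
  by rewrite ltrDl.
move=> k kd Phi; rewrite bd_map (chain_eq_map g (hbd k)).
(* For [k = 0] both sphere chains consist of the empty word; otherwise antipodal points have swapped
   labels, so [g] respects the two halves. *)
case: k kd => [//|k] kd /=; congr ev; rewrite map_cat; congr cat.
rewrite -!map_comp; apply/eq_in_map => w wh /=; rewrite -!map_comp.
apply/eq_in_map => x xw /=.
have [_ [sg fw] _] := hP k w (ltnW kd) wh.
rewrite /g coordsN; last exact: orthant_face_neq0 (fw x xw).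
exact: (lab_swap e_irr V_nonempty (coords_real x)).
Qed.

End Approximation.

Lemma coind_box_chains (V : finType) (e : rel V) (e_sym : symmetric e)
    (e_irr : irreflexive e) (V_nonempty : (0 < #|V|)%N) (R : realType) :
  exists h : nat -> seq (seq (V * bool)), let d := coind R (B0 e_sym R) in
  (forall k w, (k <= d)%N -> w \in h k ->
     [set x in w]%SET \in box_complex e /\ size w = k.+1) /\
  (forall k, (k <= d)%N ->
     chain_eq (bd (h k)) (sphere_chain (@swap_copies V) h k)).
Proof.
rewrite /coind; case: xgetP => [d _ [[f fz] _]|_] /=.
  exact: box_chains fz.
(* Without a maximum, [coind] is the junk value [0]: one vertex suffices. *)
pose v := enum_val (Ordinal V_nonempty).
exists (fun=> [:: [:: (v, false)]]); split=> [[|//] w _|[|//] _ Phi].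
  rewrite inE => /eqP ->; split=> //; apply/(box_complexP e_irr) => u u' _.
  by rewrite !inE => /eqP.
by rewrite /ev /= !big_cons.
Qed.

Theorem theorem3 (R : realType) (V : finType) (e : rel V)
    (e_sym : symmetric e) (e_irr : irreflexive e) (V_nonempty : (0 < #|V|)%N)
    (C : eqType) (c : V -> C) (c_proper : proper_coloring e c)
    (t : nat) (t_def : t = (coind R (B0 e_sym R) + 1)%N) :
  exists (s : nat) (A B : nat -> {set V}),
    (1 <= s)%N /\
    (forall i : nat, (1 <= i <= s)%N -> [disjoint A i & B i]) /\
    A 1%N = B s /\ A s = B 1%N /\
    (`| #|A 1%N| - #|B 1%N| | <= 1)%N /\
    ncolors c (A 1%N :|: B 1%N) = t /\
    (forall i : nat, (1 <= i <= s)%N -> complete_bip e (A i) (B i)) /\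
    (forall i : nat, (1 <= i <= s)%N -> #|A i :|: B i| = t) /\
    (forall i : nat, (1 <= i <= s - 1)%N ->
       (#|A i :\: A i.+1| + #|B i :\: B i.+1|)%N = 1%N /\
       (#|A i.+1 :\: A i| + #|B i.+1 :\: B i|)%N = 1%N) /\
    (forall i : nat, (1 <= i <= s)%N -> (`| #|A i| - #|B i| | <= 2)%N) /\
    (forall i : nat, (1 <= i <= s)%N -> (t - 1 <= ncolors c (A i :|: B i))%N).
Proof.
have [h [hbox hbd]] := coind_box_chains e_sym e_irr V_nonempty R.
have [S [bS cS aS pS]] :=
  connected_antipodal_altset e_sym e_irr c_proper hbox hbd.
rewrite t_def addn1 (subn1 _.+1).
exact: (antipodal_path e_irr c_proper bS cS aS pS).
Qed.
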